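(* Let $\Gamma$ be a finite, simple, connected bipartite distance degree regular graph of diameter at least $2$. Then $\Gamma$ is $1$-distance-balanced and $2$-distance-balanced.
   Context: For a vertex $u$ and integer $i\ge 0$, $N_i(u)$ is the set of vertices at distance $i$ from $u$. A connected graph $\Gamma$ of diameter $D$ is distance degree regular if $|N_i(u)| = |N_i(v)|$ for all vertices $u,v$ and all $0 \le i \le D$. For vertices $u,v$, $W_{uv} = \{w \mid d(u,w) < d(v,w)\}$. For a positive integer $\ell$, a connected graph of diameter at least $\ell$ is $\ell$-distance-balanced if $|W_{uv}| = |W_{vu}|$ for all $u,v$ with $d(u,v)=\ell$. *)

(* Defs.v *)
From mathcomp Require Import all_boot.
Set Implicit Arguments.
Unset Strict Implicit.
Unset Printing Implicit Defensive.

(* A finite simple graph is a symmetric irreflexive adjacency relation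
   [e : rel T] on a finite vertex type [T]. *)
Section Graph.
Variables (T : finType) (e : rel T).

Definition simple_graph : Prop := symmetric e /\ irreflexive e.

Definition connected_graph : Prop := forall x y : T, connect e x y.

Definition bipartite : Prop :=
  exists A : {set T}, forall x y : T, e x y -> (x \in A) != (y \in A).

Definition has_walk (n : nat) (x y : T) : bool :=
  [exists p : n.-tuple T, path e x p && (last x p == y)].

(* A shortest walk repeats no vertex, so lengths below [#|T|] suffice; the
   value is [#|T|] when [y] is not reachable from [x]. See [gdistP]. *)
Definition gdist (x y : T) : nat :=
  find (fun n => has_walk n x y) (iota 0 #|T|).

Definition diameter : nat := \max_(x : T) \max_(y : T) gdist x y.

Definition sphere (i : nat) (u : T) : {set T} := [set w | gdist u w == i].

Definition distance_degree_regular : Prop :=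
  connected_graph /\
  forall (u v : T) (i : nat), i <= diameter -> #|sphere i u| = #|sphere i v|.

Definition closer (u v : T) : {set T} := [set w | gdist u w < gdist v w].

Definition distance_balanced (l : nat) : Prop :=
  [/\ 0 < l, connected_graph, l <= diameter &
      forall u v : T, gdist u v = l -> #|closer u v| = #|closer v u|].

Lemma has_walkP n x y :
  reflect (exists p, [/\ path e x p, last x p = y & size p = n])
          (has_walk n x y).
Proof.
apply: (iffP existsP) => [[p /andP[pp /eqP <-]]|[p [pp <- /eqP sp]]].
  by exists p; rewrite size_tuple.
by exists (Tuple sp); rewrite /= pp eqxx.
Qed.

Lemma gdistP x y : connect e x y ->
  has_walk (gdist x y) x y /\ forall n, has_walk n x y -> gdist x y <= n.
Proof.
have short n : has_walk n x y ->
    exists2 m, m <= n & (m < #|T|) && has_walk m x y.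
  move=> /has_walkP[p [pp lp <-]].
  case: (shortenP pp) lp => q pq uq sq lq.
  exists (size q).
    by apply: (uniq_leq_size _ sq); case/andP: uq.
  apply/andP; split; last by apply/has_walkP; exists q.
  by move/card_uniqP: (uq) => /= <-; exact: max_card.
move=> /connectP[p pp lp].
have /short[m _ /andP[mT wm]] : has_walk (size p) x y.
  by apply/has_walkP; exists p.
have hs : has (fun n => has_walk n x y) (iota 0 #|T|).
  by apply/hasP; exists m; rewrite ?mem_iota.
have lt : gdist x y < #|T| by move: hs; rewrite has_find size_iota.
split; first by have := nth_find 0 hs; rewrite nth_iota.
move=> n /short[k le_kn /andP[kT wk]]; apply: leq_trans le_kn.
rewrite leqNgt; apply/negP => lt_k.
by have := before_find 0 lt_k; rewrite nth_iota // wk.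
Qed.

End Graph.

(* Main.v *)
Require Import Defs.
From mathcomp Require Import all_boot.
From mathcomp Require Import zify.

(** Distance degree regularity makes the total distance [\sum_w d(u, w)]
    independent of [u].  Let [d(u, v) = l] with [l] equal to 1 or 2.  For every
    [w], the difference [d(u, w) - d(v, w)] is at most [l] in absolute value by
    the triangle inequality, and it has the parity of [l] by bipartiteness, so
    it is [l], [-l] or [0].  Summing over [w] yields
    [l * |W_uv| = l * |W_vu|]. *)

Section Distance.
Variables (T : finType) (e : rel T).
Hypothesis conn : connected_graph e.

Lemma gdist_triangle y x z : gdist e x z <= gdist e x y + gdist e y z.
Proof.
have [/has_walkP[p [pp lp sp]] _] := gdistP (conn x y).
have [/has_walkP[q [pq lq sq]] _] := gdistP (conn y z).
apply: (gdistP (conn x z)).2; apply/has_walkP; exists (p ++ q).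
by rewrite cat_path last_cat size_cat pp lp pq lq sp sq.
Qed.

Lemma gdist_le_diameter x y : gdist e x y <= diameter e.
Proof.
apply: leq_trans (leq_bigmax x).
exact: (leq_bigmax (F := fun y => gdist e x y)).
Qed.

Lemma gdist_sym : symmetric e -> forall x y, gdist e x y = gdist e y x.
Proof.
move=> esym; suff le x y : gdist e x y <= gdist e y x.
  by move=> x y; apply/eqP; rewrite eqn_leq !le.
have [/has_walkP[p [pp lp sp]] _] := gdistP (conn y x).
(* A walk is stored without its starting vertex, so reversing [y :: p] and dropping the new start
   [x] gives [rev (belast y p)]. *)
apply: (gdistP (conn x y)).2; apply/has_walkP; exists (rev (belast y p)).
rewrite size_rev size_belast sp -{1}lp rev_path; split=> //.
  by rewrite (eq_path (e' := e)) // => a b; rewrite /= esym.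
by case: p lp {pp sp} => [<-|a p _] //=; rewrite rev_cons last_rcons.
Qed.

(** Grouping the vertices by their distance from [u] shows that the total distance depends only on
    the sphere sizes. *)
Lemma sum_gdist_spheres u :
  \sum_w gdist e u w = \sum_(i < (diameter e).+1) #|sphere e i u| * i.
Proof.
(* No distance exceeds the diameter, so [inord] never takes its default value. *)
rewrite (partition_big (fun w => inord (gdist e u w) : 'I_(diameter e).+1)
  xpredT) //=.
apply: eq_bigr => i _; rewrite -sum_nat_const.
apply: eq_big => [w|w /eqP <-]; last first.
  by rewrite inordK // ltnS gdist_le_diameter.
by rewrite inE -val_eqE /= inordK // ltnS gdist_le_diameter.
Qed.

Lemma sum_gdist_const : distance_degree_regular e ->
  forall u v, \sum_w gdist e u w = \sum_w gdist e v w.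
Proof.
case=> _ reg u v; rewrite !sum_gdist_spheres; apply: eq_bigr => i _.
by rewrite (reg u v) // -ltnS.
Qed.

(** Each edge of a walk switches sides, so the parity of its length is fixed by the sides of its two
    ends. *)
Lemma odd_gdist (A : {set T}) :
  (forall x y, e x y -> (x \in A) != (y \in A)) ->
  forall x y, odd (gdist e x y) = (x \in A) (+) (y \in A).
Proof.
move=> bip x y; have [/has_walkP[p [pp lp <-]] _] := gdistP (conn x y).
elim: p x pp lp => [|z p IH] x /= => [_ ->|/andP[/bip exz pp] lp].
  by rewrite addbb.
rewrite (IH z) //; move: exz.
by case: (x \in A); case: (z \in A); case: (y \in A).
Qed.

Lemma bipartite_ddr_balanced l : symmetric e -> bipartite e ->
  distance_degree_regular e -> 0 < l <= 2 -> l <= diameter e ->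
  distance_balanced e l.
Proof.
move=> esym [A bip] reg /andP[l0 l2] lD; split=> // u v duv.
(* Stated with sums to avoid truncated subtraction; at most one of the two indicators is 1. *)
have eq_w w : gdist e u w + l * (w \in closer e u v) =
              gdist e v w + l * (w \in closer e v u).
  have := gdist_triangle v u w; have := gdist_triangle u v w.
  rewrite (gdist_sym esym v u) duv !inE.
  have : odd (gdist e u w) = odd l (+) odd (gdist e v w).
    by rewrite -duv !(odd_gdist _ bip) -addbA [(v \in A) (+) _]addbA addbb.
  (* A nonzero gap is at most [l <= 2] and has the parity of [l], hence equals [l]; if the distances
     agree, both indicators vanish. *)
  by case: (ltngtP (gdist e u w) (gdist e v w)) => /=; lia.
have : \sum_w (gdist e u w + l * (w \in closer e u v)) =
       \sum_w (gdist e v w + l * (w \in closer e v u)).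
  by apply: eq_bigr => w _.
rewrite !big_split /= (sum_gdist_const reg u v) => /addnI.
rewrite -!big_distrr /= -!big_mkcond /= !sum1_card => /eqP.
by rewrite eqn_pmul2l // => /eqP.
Qed.

End Distance.

Theorem theorem2p6 (T : finType) (e : rel T)
  (hsimple : simple_graph e)
  (hconn : connected_graph e)
  (hbip : bipartite e)
  (hddr : distance_degree_regular e)
  (hdiam : 2 <= diameter e) :
  distance_balanced e 1 /\ distance_balanced e 2.
Proof.
case: hsimple => esym _.
by split; apply: bipartite_ddr_balanced => //; apply: ltnW.
Qed.
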